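(* Let $n \geq 1$ be an integer, let $X$ be the random walk on the $n$-star with vertex set $\{0,1,\ldots,n\}$ and center $0$, and let $\mu,\nu$ be probability distributions on $\{0,\ldots,n\}$. Then the optimal transport time $H(\mu,\nu)$ from $\mu$ to $\nu$ using $X$ satisfies $$H(\mu,\nu) = \nu_0 - \mu_0 + 2n\Big(\max_{j\in\{1,\ldots,n\}} (\nu_j-\mu_j)\Big)_+.$$ In particular, for every $j\in\{1,\ldots,n\}$, $$\nu_0-\mu_0 + 2n(\nu_j-\mu_j)_+ \leq H(\mu,\nu) \leq (2n+1)\|\mu-\nu\|_{TV} \leq 2n+1 = O(n).$$
   Context: The $n$-star is the graph on $\{0,\ldots,n\}$ whose edges are exactly those joining $0$ to each of $1,\ldots,n$. The random walk on it is the discrete-time Markov chain which at each step moves to a uniformly chosen neighbour: $p_{0,j} = 1/n$ and $p_{j,0} = 1$ for $1 \leq j \leq n$, and all other transition probabilities are $0$. For probability distributions $\mu,\nu$ on the state space, the optimal transport time (also called access time) is $H(\mu,\nu) := \inf_{T} \mathbb{E}[T]$, where $X_0 \sim \mu$ and the infimum is over all almost surely finite, possibly randomized, stopping times $T$ of $X$ such that $X_T \sim \nu$. (A randomized stopping time is a stopping time with respect to a filtration $\mathcal{F}_t = \sigma(U, X_0,\dots,X_t)$, where $U$ is uniform on $[0,1]$ and independent of $X$.) The total variation distance is $\|\mu-\nu\|_{TV} := \sup_{A} |\mu(A)-\nu(A)| = \frac12\sum_{j}|\mu_j-\nu_j|$, and $x_+ := \max\{x,0\}$. *)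

(* Defs.v *)
From HB Require Import structures.
From mathcomp Require Import all_boot all_order all_algebra.
From mathcomp Require Import all_classical all_reals all_analysis.

Set Implicit Arguments.
Unset Strict Implicit.
Unset Printing Implicit Defensive.

Import Order.TTheory GRing.Theory Num.Theory.
Import numFieldNormedType.Exports.

Local Open Scope classical_set_scope.
Local Open Scope ring_scope.

Section FiniteStateSpace.
Context (R : realType) (S : finType).

Definition is_distr (mu : S -> R) : Prop :=
  (forall i, 0 <= mu i) /\ \sum_i mu i = 1.

Definition tv_dist (mu nu : S -> R) : R :=
  sup [set `|\sum_(i in A) mu i - \sum_(i in A) nu i| | A in [set: {set S}]].

Definition walk_trans (e : rel S) (i j : S) : R :=
  if e i j then (#|[pred k | e i k]|%:R)^-1 else 0.

End FiniteStateSpace.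

Definition star_edge (n : nat) : rel 'I_n.+1 :=
  fun i j => ((i == ord0) && (j != ord0)) || ((i != ord0) && (j == ord0)).

Definition star_trans (R : realType) (n : nat) : 'I_n.+1 -> 'I_n.+1 -> R :=
  walk_trans R (@star_edge n).

Lemma star_trans0j (R : realType) (n : nat) (j : 'I_n.+1) :
  j != ord0 -> star_trans R ord0 j = n%:R^-1.
Proof.
move=> j0; rewrite /star_trans /walk_trans /star_edge eqxx j0 /=.
congr (_%:R^-1).
have -> : #|[pred k : 'I_n.+1 | (k != ord0) || false]|
        = #|[predC (pred1 (ord0 : 'I_n.+1))]|.
  by apply: eq_card => k; rewrite !inE orbF.
by rewrite cardC1 card_ord.
Qed.

Lemma star_transj0 (R : realType) (n : nat) (j : 'I_n.+1) :
  j != ord0 -> star_trans R j ord0 = 1.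
Proof.
move=> j0; rewrite /star_trans /walk_trans /star_edge eqxx j0 /= orbT.
have -> : #|[pred k : 'I_n.+1 | [|| (j == ord0) && (k != ord0) | k == ord0]]|
        = #|pred1 (ord0 : 'I_n.+1)|.
  by apply: eq_card => k; rewrite !inE (negbTE j0).
by rewrite card1 invr1.
Qed.

Section Process.
Context (R : realType) (S : finType).
Context (d : measure_display) (Omega : measurableType d).
Context (P : probability Omega R).

Definition cylinder (X : nat -> Omega -> S) (t : nat) (x : nat -> S) :
    set Omega :=
  [set w | forall k, (k <= t)%N -> X k w = x k].

(* The one-step condition is the conditional-probability form of the Markov
   property multiplied by the probability of the conditioning event, so that
   null conditioning events need no special treatment. *)
Definition markov_chain (mu : S -> R) (p : S -> S -> R)
    (X : nat -> Omega -> S) : Prop :=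
  [/\ forall t i, measurable (X t @^-1` [set i]),
      forall i, P (X 0%N @^-1` [set i]) = (mu i)%:E
    & forall t x, P (cylinder X t.+1 x)
                  = (P (cylinder X t x) * (p (x t) (x t.+1))%:E)%E].

Definition uniform01 (U : {RV P >-> R}) : Prop :=
  forall B : set R, measurable B ->
    P (U @^-1` B) = uniform_prob (@ltr01 R) B.

Definition indep_rv_process (U : {RV P >-> R}) (X : nat -> Omega -> S) : Prop :=
  forall (B : set R) (A : set Omega),
    measurable B ->
    <<s [set C | exists t i, C = X t @^-1` [set i]] >> A ->
    P (U @^-1` B `&` A) = (P (U @^-1` B) * P A)%E.

(* sigma(U, X_0, ..., X_t) *)
Definition filtration (U : {RV P >-> R}) (X : nat -> Omega -> S) (t : nat) :
    set_system Omega :=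
  <<s [set C | (exists2 B : set R, measurable B & C = U @^-1` B) \/
               (exists k i, (k <= t)%N /\ C = X k @^-1` [set i])] >>.

(* Random times take values in nat together with infinity, encoded as None. *)
Definition stopping_time (U : {RV P >-> R}) (X : nat -> Omega -> S)
    (T : Omega -> option nat) : Prop :=
  forall t, filtration U X t [set w | exists2 k, T w = Some k & (k <= t)%N].

Definition as_finite (T : Omega -> option nat) : Prop :=
  {ae P, forall w, T w <> None}.

Definition stopped_law (X : nat -> Omega -> S) (T : Omega -> option nat)
    (nu : S -> R) : Prop :=
  forall i, P [set w | exists2 k, T w = Some k & X k w = i] = (nu i)%:E.

Definition time_val (k : option nat) : \bar R :=
  if k is Some m then m%:R%:E else +oo%E.

Definition mean_time (T : Omega -> option nat) : \bar R :=
  (\int[P]_w time_val (T w))%E.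

(* The initial law is that of X 0, so only the target law is an argument. *)
Definition transport_time (U : {RV P >-> R}) (X : nat -> Omega -> S)
    (nu : S -> R) : \bar R :=
  ereal_inf [set mean_time T | T in
    [set T | [/\ stopping_time U X T, as_finite T & stopped_law X T nu]]].

End Process.

(* Main.v *)
Require Import Defs.
From HB Require Import structures.
From mathcomp Require Import all_boot all_order all_algebra.
From mathcomp Require Import all_classical all_reals all_analysis.
From mathcomp Require Import measurable_realfun.
From mathcomp Require Import zify lra ring.

Import Order.TTheory GRing.Theory Num.Theory.
Import numFieldNormedType.Exports.

(** Write G_j for the expected number of times t < T with X_t = j. Counting
the mass that enters and leaves each state before time T gives the balance
nu_j - mu_j = sum_i G_i p_ij - G_j. On the star this says that
nu_j - mu_j = G_0 / n - G_j at a leaf j, and that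
nu_0 - mu_0 = (sum of G over the leaves) - G_0, so that
E T = sum_i G_i = nu_0 - mu_0 + 2 G_0. Minimizing E T is therefore the same as
minimizing the number of departures from the center.

Lower bound: G_0 = n (nu_j - mu_j + G_j) for each leaf j, and both G_0 and G_j
are nonnegative, hence G_0 >= n (nu_j - mu_j)_+. The balance is proved for
T truncated at m ([stopping_balance]); truncation costs an error bounded by a
multiple of P(T >= m), and m P(T >= m) <= E T makes it vanish
([star_mean_time_ge]).

Upper bound: use the greedy (filling) rule. Whenever mass arrives at a state
whose target is not yet met, as much of it as possible stops there. A state
that is still unfilled has let nothing through, and as long as some mass is
alive some state is unfilled; so at each time there is a state j with G_j = 0
so far ([exists_total_overflow0]). If j is the center then G_0 = 0, and if j
is a leaf then the balance gives G_0 <= n (nu_j - mu_j). Either way the lower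
bound is matched, up to every finite horizon ([star_filling_bound]). The bound
on E T alone then forces T to be almost surely finite and X_T to have law nu
([filling_rule_admissible]).

The filling rule prescribes, at time t in state i, a conditional halting
probability q t i. A single uniform U implements all these coins at once: T > t
exactly when U < prod_{k <= t} (1 - q k (X_k)). This is the right conditional
probability because U is independent of the path ([pr_continue_threshold]).
Everything that involves U and the path together rests on the fact that, on
the event that the path up to time t is a given one, an event of the
filtration at time t depends on U only ([filtration_cylinder]). *)

Set Implicit Arguments.
Unset Strict Implicit.
Unset Printing Implicit Defensive.

Local Open Scope classical_set_scope.
Local Open Scope ring_scope.

(** * The filling scheme *)

Section FillingScheme.
Context (R : realType) (S : finType) (p : S -> S -> R) (mu nu : S -> R).

(** The pair of the mass that reaches each state at time t without having
stopped earlier, and the part of the target nu that is still unmet there. *)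
Fixpoint fill (t : nat) : (S -> R) * (S -> R) :=
  if t is t'.+1 then
    let: (a, r) := fill t' in
    (fun j => \sum_i (a i - Num.min (a i) (r i)) * p i j,
     fun j => r j - Num.min (a j) (r j))
  else (mu, nu).

Definition incoming t := (fill t).1.
Definition demand t := (fill t).2.
Definition filled t j := Num.min (incoming t j) (demand t j).
Definition overflow t j := incoming t j - filled t j.

(** The expected number of times t < m spent in j by mass that goes on moving. *)
Definition total_overflow m j := \sum_(t < m) overflow t j.

Lemma incomingS t j : incoming t.+1 j = \sum_i overflow t i * p i j.
Proof.
by rewrite /incoming /overflow /filled /incoming /demand /=; case: (fill t).
Qed.

Lemma demandS t j : demand t.+1 j = demand t j - filled t j.
Proof. by rewrite /filled /incoming /demand /=; case: (fill t). Qed.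

Lemma total_overflowS m j : total_overflow m.+1 j = total_overflow m j + overflow m j.
Proof. by rewrite /total_overflow big_ord_recr. Qed.

Hypothesis p_ge0 : forall i j, 0 <= p i j.
Hypothesis p_sum1 : forall i, \sum_j p i j = 1.
Hypotheses (mu_distr : is_distr mu) (nu_distr : is_distr nu).

Lemma overflow_ge0 t j : 0 <= overflow t j.
Proof. by rewrite subr_ge0 ge_min lexx. Qed.

Lemma incoming_ge0 t j : 0 <= incoming t j.
Proof.
case: t => [|t]; first exact: mu_distr.1.
by rewrite incomingS sumr_ge0// => i _; rewrite mulr_ge0 ?overflow_ge0.
Qed.

Lemma demandS_ge0 t j : 0 <= demand t.+1 j.
Proof. by rewrite demandS subr_ge0 ge_min lexx orbT. Qed.

Lemma demand_ge0 t j : 0 <= demand t j.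
Proof. by case: t => [|t]; [exact: nu_distr.1|exact: demandS_ge0]. Qed.

Lemma filled_ge0 t j : 0 <= filled t j.
Proof. by rewrite le_min incoming_ge0 demand_ge0. Qed.

Lemma le_demand s t j : (s <= t)%N -> demand t j <= demand s j.
Proof.
move=> /subnK <-; elim: (t - s)%N => [|k IH]; first by rewrite add0n.
by rewrite addSn (le_trans _ IH)// demandS gerBl filled_ge0.
Qed.

Lemma total_overflow_ge0 m j : 0 <= total_overflow m j.
Proof. by rewrite sumr_ge0// => t _; exact: overflow_ge0. Qed.

(** Both totals start at 1 and lose the mass that stops; moving preserves
mass. *)
Lemma sum_incoming_demand t : \sum_j incoming t j = \sum_j demand t j.
Proof.
elim: t => [|t IH]; first by rewrite mu_distr.2 nu_distr.2.
under eq_bigr do rewrite incomingS.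
under [RHS]eq_bigr do rewrite demandS.
rewrite exchange_big/=.
under eq_bigr do rewrite -mulr_sumr p_sum1 mulr1.
by rewrite !sumrB IH.
Qed.

Lemma sum_overflow_demand t : \sum_j overflow t j = \sum_j demand t.+1 j.
Proof.
under [RHS]eq_bigr do rewrite demandS.
by rewrite !sumrB sum_incoming_demand.
Qed.

Lemma overflow_unfilled t j : 0 < demand t.+1 j -> overflow t j = 0.
Proof.
rewrite demandS /overflow /filled.
by case: (leP (incoming t j) (demand t j)) => _; rewrite subrr// ltxx.
Qed.

(** If some demand is left after time m, then it is left at some state j,
whose demand was positive at all earlier times too, so that j has let no mass
through. If none is left, then nothing overflows at time m and the state found
one step before still works. *)
Lemma exists_total_overflow0 (j0 : S) m : exists j, total_overflow m j = 0.
Proof.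
elim: m => [|m [j IH]]; first by exists j0; rewrite /total_overflow big_ord0.
have [r0|] := eqVneq (\sum_j demand m.+1 j) 0.
  exists j; rewrite total_overflowS IH add0r.
  by apply: (@psumr_eq0P _ _ predT) => //; [move=> *; exact: overflow_ge0
    | rewrite sum_overflow_demand].
rewrite psumr_neq0; last by move=> *; exact: demandS_ge0.
move=> /hasP[k _ /= rk]; exists k; rewrite /total_overflow big1// => t _.
by apply: overflow_unfilled; rewrite (lt_le_trans rk)// le_demand.
Qed.

(** By induction on m: what stops is incoming minus overflow, and the overflow
moves by one step of p. The term incoming - demand is the correction for the
finite horizon m. *)
Lemma total_overflow_balance m j :
  nu j - demand m j + incoming m j
  = mu j + \sum_i total_overflow m i * p i j - total_overflow m j.
Proof.
elim: m => [|m IH].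
  rewrite /total_overflow big_ord0 big1 => [|i _]; last by rewrite big_ord0 mul0r.
  by rewrite /demand /incoming /=; ring.
rewrite total_overflowS incomingS demandS.
under [in RHS]eq_bigr do rewrite total_overflowS mulrDl.
rewrite big_split/=.
have -> : filled m j = incoming m j - overflow m j by rewrite subKr.
by move: IH; lra.
Qed.

Lemma le_incoming m j : incoming m j <= demand m j + overflow m j.
Proof. by rewrite /overflow /filled; case: (leP (incoming m j) (demand m j)); lra. Qed.

End FillingScheme.

(** * The star *)

Section StarChain.
Context (R : realType) (n : nat).
Hypothesis n_gt0 : (0 < n)%N.
Local Notation p := (@star_trans R n).

Lemma star_trans00 : p ord0 ord0 = 0.
Proof. by rewrite /star_trans /walk_trans /star_edge eqxx. Qed.

Lemma star_trans_leaf (i j : 'I_n.+1) : i != ord0 -> j != ord0 -> p i j = 0.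
Proof.
by move=> /negbTE i0 /negbTE j0; rewrite /star_trans /walk_trans /star_edge i0 j0.
Qed.

Lemma star_trans_ge0 i j : 0 <= p i j.
Proof. by rewrite /star_trans /walk_trans; case: ifP. Qed.

Lemma star_flow0 (g : 'I_n.+1 -> R) :
  \sum_i g i * p i ord0 = \sum_(i | i != ord0) g i.
Proof.
rewrite (bigD1 ord0)//= star_trans00 mulr0 add0r.
by apply: eq_bigr => i i0; rewrite star_transj0 ?mulr1.
Qed.

Lemma star_flow_leaf (g : 'I_n.+1 -> R) j : j != ord0 ->
  \sum_i g i * p i j = g ord0 / n%:R.
Proof.
move=> j0; rewrite (bigD1 ord0)//= star_trans0j// big1 ?addr0// => i i0.
by rewrite star_trans_leaf// mulr0.
Qed.

Lemma star_trans_sum1 i : \sum_j p i j = 1.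
Proof.
rewrite (bigD1 ord0)//=; have [->|i0] := eqVneq i ord0.
  rewrite star_trans00 add0r.
  under eq_bigr do rewrite star_trans0j//.
  rewrite sumr_const.
  have -> : #|[pred j : 'I_n.+1 | j != ord0]| = n.
    by rewrite cardC1 card_ord.
  by rewrite -[LHS]mulr_natr mulVf// pnatr_eq0 -lt0n.
by rewrite star_transj0// big1 ?addr0// => j j0; rewrite star_trans_leaf.
Qed.

(** The state that [exists_total_overflow0] provides bounds the overflow at
the center, and the balance at the center converts this into a bound on the
total overflow. *)
Lemma star_filling_bound (mu nu : 'I_n.+1 -> R) (M : R) m :
  is_distr mu -> is_distr nu ->
  0 <= M -> (forall j, j != ord0 -> nu j - mu j <= M) ->
  \sum_j total_overflow p mu nu m j <= nu ord0 - mu ord0 + (2 * n)%:R * M.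
Proof.
move=> dmu dnu M0 hM.
have G0 m' : total_overflow p mu nu m' ord0 <= n%:R * M.
  (* The horizon m'.+1 also gives zero overflow at time m', and hence
     incoming <= demand in the balance at m'. *)
  have [j Gj] := @exists_total_overflow0 _ _ p mu nu star_trans_ge0
    star_trans_sum1 dmu dnu ord0 m'.+1.
  have Gm'0 : total_overflow p mu nu m' j = 0 /\ overflow p mu nu m' j = 0.
    move: Gj; rewrite total_overflowS.
    have := total_overflow_ge0 p mu nu m' j; have := overflow_ge0 p mu nu m' j.
    by split; lra.
  have [j0|j0] := eqVneq j ord0.
    by rewrite -j0 Gm'0.1 mulr_ge0.
  have := total_overflow_balance p mu nu m' j.
  rewrite star_flow_leaf// Gm'0.1 subr0 => bal.
  have := le_incoming p mu nu m' j; rewrite Gm'0.2 => le.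
  have n0 : (0 : R) < n%:R by rewrite ltr0n.
  rewrite mulrC -ler_pdivrMr//.
  by have := hM j j0; lra.
have := total_overflow_balance p mu nu m ord0; rewrite star_flow0 => bal.
have := le_incoming p mu nu m ord0.
have := G0 m; have := G0 m.+1; rewrite total_overflowS.
by rewrite (bigD1 ord0)//= natrM; lra.
Qed.

End StarChain.

(** * Real-valued probabilities and generated sigma-algebras *)

(** Limits m -> oo are taken in this form: all error terms below are at most
C / m. *)
Lemma archimedean_le0 (R : realType) (y C : R) :
  (forall m : nat, m%:R * y <= C) -> y <= 0.
Proof.
move=> h; rewrite leNgt; apply/negP => y0.
have := h (Num.truncn (C / y)).+1.
by rewrite leNgt -ltr_pdivrMr// truncnS_gt.
Qed.

Section Probability.
Context (R : realType) (d : measure_display) (Omega : measurableType d).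
Context (P : probability Omega R).

(** The real value of a probability, so that the balance equations are
equations in a field. *)
Definition pr (A : set Omega) : R := fine (P A).

Lemma pr_EFin A : measurable A -> P A = (pr A)%:E.
Proof. by move=> mA; rewrite /pr fineK// fin_num_measure. Qed.

Lemma pr_ge0 A : 0 <= pr A.
Proof. by rewrite /pr fine_ge0. Qed.

Lemma pr0 : pr set0 = 0.
Proof. by rewrite /pr measure0. Qed.

Lemma prU A B : measurable A -> measurable B -> A `&` B = set0 ->
  pr (A `|` B) = pr A + pr B.
Proof.
move=> mA mB AB0; apply: EFin_inj; rewrite EFinD -!pr_EFin//; last exact: measurableU.
exact: measureU.
Qed.

Lemma le_pr A B : measurable A -> measurable B -> A `<=` B -> pr A <= pr B.
Proof.
by move=> mA mB AB; rewrite -lee_fin -!pr_EFin// le_measure// inE.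
Qed.

Lemma total_probability (I : finType) (Y : Omega -> I) (E : set Omega) :
  (forall i, measurable (Y @^-1` [set i])) -> measurable E ->
  pr E = \sum_i pr (E `&` Y @^-1` [set i]).
Proof.
move=> mY mE.
have mEY i : measurable (E `&` Y @^-1` [set i]) by exact: measurableI.
have EE : E = \bigcup_(i in [set` index_enum I]) (E `&` Y @^-1` [set i]).
  rewrite -setI_bigcupr; apply/seteqP; split=> [w Ew|w []//].
  by split=> //; exists (Y w) => //=; exact: mem_index_enum.
apply: EFin_inj; rewrite -sumEFin -pr_EFin// {1}EE measure_fin_bigcup//.
- rewrite -fsbig_seq ?index_enum_uniq//.
  by apply: eq_bigr => i _; exact: pr_EFin.
- by move=> i j _ _ [w [[_ <-] [_ <-]]].
Qed.

End Probability.

Section SigmaClosure.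
Context (T : pointedType) (G : set_system T).

Lemma sigmaI A B : <<s G >> A -> <<s G >> B -> <<s G >> (A `&` B).
Proof. exact: (@measurableI _ (g_sigma_algebraType G)). Qed.

Lemma sigma_fin_bigcup (I : finType) (F : I -> set T) :
  (forall i, <<s G >> (F i)) -> <<s G >> (\bigcup_i F i).
Proof.
move=> mF; apply: (@fin_bigcup_measurable _ (g_sigma_algebraType G)) => // i _.
exact: mF.
Qed.

End SigmaClosure.

(** * The Markov property for the randomized filtration *)

Section RandomizedProcess.
Context (R : realType) (S : finType) (d : measure_display).
Context (Omega : measurableType d) (P : probability Omega R).
Context (mu : S -> R) (p : S -> S -> R).
Context (U : {RV P >-> R}) (X : nat -> Omega -> S).
Hypothesis hX : markov_chain P mu p X.
Hypothesis hUX : indep_rv_process U X.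

Lemma measurable_state t i : measurable (X t @^-1` [set i]).
Proof. by have [+ _ _] := hX; exact. Qed.

Lemma cylinder0 x : cylinder X 0 x = X 0%N @^-1` [set x 0%N].
Proof.
apply/seteqP; split=> w; first exact.
by move=> /= Xx [|k]//; rewrite ltn0.
Qed.

Lemma cylinderS t x :
  cylinder X t.+1 x = cylinder X t x `&` X t.+1 @^-1` [set x t.+1].
Proof.
apply/seteqP; split=> w.
  by move=> h; split=> [k kt|]; apply: h => //; exact: leqW.
by move=> [h1 h2] k; rewrite leq_eqVlt => /predU1P[->//|]; exact: h1.
Qed.

Lemma eq_cylinder t x y : (forall k, (k <= t)%N -> x k = y k) ->
  cylinder X t x = cylinder X t y.
Proof.
by move=> xy; apply/seteqP; split=> w h k kt; rewrite h// xy.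
Qed.

Lemma cylinder_sigma (G : set_system Omega) t x :
  (forall k, (k <= t)%N -> <<s G >> (X k @^-1` [set x k])) ->
  <<s G >> (cylinder X t x).
Proof.
elim: t => [|t IH] h; first by rewrite cylinder0; exact: h.
rewrite cylinderS; apply: sigmaI; last exact: h.
by apply: IH => k kt; apply: h; exact: leqW.
Qed.

Lemma cylinder_process t x :
  <<s [set C | exists t i, C = X t @^-1` [set i]] >> (cylinder X t x).
Proof.
apply: cylinder_sigma => k _; apply: sub_sigma_algebra.
by exists k, (x k).
Qed.

Lemma measurable_cylinder t x : measurable (cylinder X t x).
Proof.
apply: smallest_sub (cylinder_process t x); first exact: sigma_algebra_measurable.
by move=> _ [k [i ->]]; exact: measurable_state.
Qed.

(** On a path cylinder X_0, ..., X_t are constant, so only the dependence on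
U is left. The sets with this property form a sigma-algebra that contains the
generators of the filtration. *)
Lemma filtration_cylinder t E x : filtration U X t E ->
  exists2 B : set R, measurable B &
    E `&` cylinder X t x = U @^-1` B `&` cylinder X t x.
Proof.
set Q := fun E : set Omega => exists2 B : set R, measurable B &
    E `&` cylinder X t x = U @^-1` B `&` cylinder X t x.
apply: (@smallest_sub _ _ _ Q); first split.
- by exists set0 => //; rewrite preimage_set0.
- move=> A [B mB AB]; exists (~` B); first exact: measurableC.
  rewrite setTD preimage_setC; apply/seteqP; split => w [Aw cw]; split=> //.
    by move=> Bw; apply: Aw; have [] : (A `&` cylinder X t x) w by rewrite AB.
  by move=> Bw; apply: Aw; have [] : (U @^-1` B `&` cylinder X t x) w by rewrite -AB.
- move=> A /(_ _)/cid2-/all_sig2[B mB AB].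
  exists (\bigcup_k B k); first exact: bigcup_measurable.
  rewrite preimage_bigcup !setI_bigcupl.
  by apply: eq_bigcupr => k _; exact: AB.
- move=> C [[B mB ->]|[k [i [kt ->]]]]; first by exists B.
  have [xi|xi] := eqVneq (x k) i.
    exists setT => //; rewrite preimage_setT setTI; apply: setIidr.
    by move=> w cw; rewrite /= cw.
  exists set0 => //; rewrite preimage_set0 set0I.
  apply/seteqP; split => // w [/= Xi cw]; move: xi.
  by rewrite -Xi cw ?eqxx.
Qed.

(** Only the values at k <= t matter; beyond t, [inord] returns a junk
index. *)
Definition extend t (f : {ffun 'I_t.+1 -> S}) (k : nat) : S := f (inord k).

Definition path_upto t (w : Omega) : {ffun 'I_t.+1 -> S} := [ffun k => X (k : 'I_t.+1) w].

Lemma path_upto_preimage t f :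
  path_upto t @^-1` [set f] = cylinder X t (extend f).
Proof.
apply/seteqP; split=> w /=.
  by move=> <- k kt; rewrite /extend ffunE inordK.
move=> h; apply/ffunP => k; rewrite ffunE h ?leq_ord//.
by rewrite /extend inord_val.
Qed.

Lemma pr_paths t E : measurable E ->
  pr P E = \sum_(f : {ffun 'I_t.+1 -> S}) pr P (E `&` cylinder X t (extend f)).
Proof.
move=> mE; rewrite (@total_probability _ _ _ P _ (@path_upto t))//.
  by apply: eq_bigr => f _; rewrite path_upto_preimage.
by move=> f; rewrite path_upto_preimage; exact: measurable_cylinder.
Qed.

(** Converse of [filtration_cylinder], by gluing the finitely many
cylinders. *)
Lemma filtration_of_cylinders t E :
  (forall x, exists2 B : set R, measurable B &
    E `&` cylinder X t x = U @^-1` B `&` cylinder X t x) ->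
  filtration U X t E.
Proof.
move=> h.
have -> : E = \bigcup_(f : {ffun 'I_t.+1 -> S}) (E `&` cylinder X t (extend f)).
  rewrite -setI_bigcupr; apply/seteqP; split=> [w Ew|w []//].
  split=> //; exists (path_upto t w) => //.
  by rewrite -path_upto_preimage.
apply: sigma_fin_bigcup => f; have [B mB ->] := h (extend f).
apply: sigmaI; first by apply: sub_sigma_algebra; left; exists B.
by apply: cylinder_sigma => k kt; apply: sub_sigma_algebra; right; exists k, (extend f k).
Qed.

Lemma measurable_preU B : measurable B -> measurable (U @^-1` B).
Proof. exact: measurable_funPTI. Qed.

Lemma filtration_measurable t E : filtration U X t E -> measurable E.
Proof.
apply: smallest_sub; first exact: sigma_algebra_measurable.
move=> C [[B mB ->]|[k [i [_ ->]]]]; last exact: measurable_state.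
exact: measurable_preU.
Qed.

Lemma pr_indep t x B : measurable B ->
  pr P (U @^-1` B `&` cylinder X t x) = pr P (U @^-1` B) * pr P (cylinder X t x).
Proof.
move=> mB; apply: EFin_inj; rewrite EFinM -!pr_EFin.
- by apply: hUX => //; exact: cylinder_process.
- exact: measurable_cylinder.
- exact: measurable_preU.
- by apply: measurableI; [exact: measurable_preU|exact: measurable_cylinder].
Qed.

Lemma pr_cylinderS t x :
  pr P (cylinder X t.+1 x) = pr P (cylinder X t x) * p (x t) (x t.+1).
Proof.
have [_ _ h] := hX; apply: EFin_inj; rewrite EFinM -!pr_EFin//;
exact: measurable_cylinder.
Qed.

Lemma pr_init i : pr P (X 0%N @^-1` [set i]) = mu i.
Proof. by have [_ h _] := hX; rewrite /pr h. Qed.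

(** On each path cylinder ending in i, the event E depends on U only, and U
is independent of the path up to time t.+1; the one-step Markov property then
applies to the cylinder. *)
Lemma markov_filtration t E i j : filtration U X t E ->
  pr P (E `&` X t @^-1` [set i] `&` X t.+1 @^-1` [set j])
  = pr P (E `&` X t @^-1` [set i]) * p i j.
Proof.
move=> FE; have mE := filtration_measurable FE.
have mEi : measurable (E `&` X t @^-1` [set i]).
  by apply: measurableI => //; exact: measurable_state.
rewrite (pr_paths t mEi) (@pr_paths t); last first.
  by apply: measurableI => //; exact: measurable_state.
rewrite mulr_suml; apply: eq_bigr => f _.
have [fi|fi] := eqVneq (extend f t) i; last first.
  have e0 : E `&` X t @^-1` [set i] `&` cylinder X t (extend f) = set0.
    apply/seteqP; split=> // w [[_ /= Xi] cw]; move: fi.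
    by rewrite -Xi cw ?eqxx.
  by rewrite [X in pr P X = _]setIAC e0 set0I pr0 mul0r.
have [B mB EB] := filtration_cylinder (extend f) FE.
have ci : X t @^-1` [set i] `&` cylinder X t (extend f) = cylinder X t (extend f).
  by apply: setIidr => w cw /=; rewrite cw.
have EiB : E `&` X t @^-1` [set i] `&` cylinder X t (extend f)
    = U @^-1` B `&` cylinder X t (extend f) by rewrite -setIA ci.
rewrite [X in pr P X = _]setIAC EiB (pr_indep t (extend f) mB).
(* The path f continued by a step to j. *)
pose y k := if (k <= t)%N then extend f k else j.
have cy : cylinder X t (extend f) = cylinder X t y.
  by apply: eq_cylinder => k kt; rewrite /y kt.
rewrite -setIA cy.
have -> : X t.+1 @^-1` [set j] = X t.+1 @^-1` [set y t.+1].
  by rewrite /y ltnn.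
by rewrite -cylinderS pr_indep// pr_cylinderS {2}/y leqnn fi /y ltnn mulrA.
Qed.

Lemma pr_state_split t E : measurable E ->
  pr P E = \sum_i pr P (E `&` X t @^-1` [set i]).
Proof. by apply: total_probability => i; exact: measurable_state. Qed.

Lemma markov_flow t E j : filtration U X t E ->
  pr P (E `&` X t.+1 @^-1` [set j]) = \sum_i pr P (E `&` X t @^-1` [set i]) * p i j.
Proof.
move=> FE; rewrite (@pr_state_split t); last first.
  by apply: measurableI; [exact: filtration_measurable FE|exact: measurable_state].
by apply: eq_bigr => i _; rewrite setIAC markov_filtration.
Qed.

End RandomizedProcess.

(** * Mass balance for stopping times *)

Section StoppingTimes.
Context (R : realType) (S : finType) (d : measure_display).
Context (Omega : measurableType d) (P : probability Omega R).
Context (mu : S -> R) (p : S -> S -> R).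
Context (U : {RV P >-> R}) (X : nat -> Omega -> S).
Hypothesis hX : markov_chain P mu p X.
Hypothesis hUX : indep_rv_process U X.
Context (T : Omega -> option nat).

(** The event T >= m. *)
Definition alive m : set Omega := [set w | forall k, (k < m)%N -> T w <> Some k].

Definition stopped_before m i : set Omega :=
  [set w | exists2 k, T w = Some k & (k < m)%N /\ X k w = i].

Definition stopped_in i : set Omega := [set w | exists2 k, T w = Some k & X k w = i].

Definition pr_continue m i : R := pr P (alive m.+1 `&` X m @^-1` [set i]).

Definition expected_visits m i : R := \sum_(t < m) pr_continue t i.

Lemma alive0 : alive 0 = setT.
Proof. by apply/seteqP; split. Qed.

(** The complement of an event from the definition of a stopping time: it
belongs to the filtration at time m. *)
Lemma aliveSE m :
  alive m.+1 = ~` [set w | exists2 k, T w = Some k & (k <= m)%N].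
Proof.
apply/seteqP; split=> w h; first by move=> [k Tk km]; exact: (h k).
by move=> k km Tk; apply: h; exists k.
Qed.

Lemma aliveS m w : alive m.+1 w <-> alive m w /\ T w <> Some m.
Proof.
split=> [h|[h hm] k].
  by split=> [k km|]; apply: h => //; exact: ltnW.
by rewrite ltnS leq_eqVlt => /predU1P[->//|]; exact: h.
Qed.

Lemma sub_alive m m' : (m <= m')%N -> alive m' `<=` alive m.
Proof. by move=> mm w h k km; apply: h; exact: leq_trans mm. Qed.

Hypothesis hT : stopping_time U X T.

Lemma filtration_aliveS m : filtration U X m (alive m.+1).
Proof. by rewrite aliveSE; apply: sigma_algebraC; exact: hT. Qed.

Lemma measurable_alive m : measurable (alive m).
Proof.
case: m => [|m]; first by rewrite alive0; exact: measurableT.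
exact: (filtration_measurable hX (@filtration_aliveS m)).
Qed.

Lemma measurable_at m m' i : measurable (alive m `&` X m' @^-1` [set i]).
Proof.
by apply: measurableI; [exact: measurable_alive|exact: (measurable_state hX)].
Qed.

(** The event that T = m and X_m = i, written with [alive] so that its
measurability is immediate. *)
Definition stop_now m i := (alive m `\` alive m.+1) `&` X m @^-1` [set i].

Lemma stop_nowE m i w : stop_now m i w <-> T w = Some m /\ X m w = i.
Proof.
split=> [[[am nm] Xi]|[Tm Xi]].
  split=> //; apply: contrapT => Tm; apply: nm; exact/aliveS.
split=> //; split; first by move=> k km; rewrite Tm => -[km']; rewrite km' ltnn in km.
by move=> /aliveS[].
Qed.

Lemma measurable_stop_now m i : measurable (stop_now m i).
Proof.
apply: measurableI; last exact: (measurable_state hX).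
by apply: measurableD; exact: measurable_alive.
Qed.

Lemma stopped_beforeS m i : stopped_before m.+1 i = stopped_before m i `|` stop_now m i.
Proof.
apply/seteqP; split=> w.
  move=> [k Tk []]; rewrite ltnS leq_eqVlt => /predU1P[km|km] Xi.
    by right; apply/stop_nowE; rewrite -km.
  by left; exists k.
move=> [[k Tk [km Xi]]|/stop_nowE[Tm Xi]]; last by exists m.
by exists k => //; split=> //; exact: ltnW.
Qed.

Lemma stopped_before0 i : stopped_before 0 i = set0.
Proof. by apply/seteqP; split=> // w [k _ []]. Qed.

Lemma measurable_stopped_before m i : measurable (stopped_before m i).
Proof.
elim: m => [|m IH]; first by rewrite stopped_before0.
by rewrite stopped_beforeS; apply: measurableU => //; exact: measurable_stop_now.
Qed.

Lemma pr_stopped_beforeS m i :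
  pr P (stopped_before m.+1 i) = pr P (stopped_before m i) + pr P (stop_now m i).
Proof.
rewrite stopped_beforeS prU//; [exact: measurable_stopped_before|
  exact: measurable_stop_now|].
apply/seteqP; split=> // w [[k Tk [km _]] /stop_nowE[Tm _]].
by move: km; move: Tk; rewrite Tm => -[->]; rewrite ltnn.
Qed.

Lemma pr_alive_split m i : pr P (alive m `&` X m @^-1` [set i])
  = pr P (stop_now m i) + pr_continue m i.
Proof.
rewrite -prU; [|exact: measurable_stop_now|exact: measurable_at|].
  congr pr; rewrite -setIUl; congr (_ `&` _).
  apply/seteqP; split=> w.
    by case: (pselect (alive m.+1 w)); [right|left].
  by move=> [[]//|]; exact: sub_alive.
by apply/seteqP; split=> // w [[[_ +] _] [+ _]].
Qed.

(** The left side is the law at j of X at the minimum of T and m. Passing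
from m to m.+1 moves exactly the mass with T > m, and this mass moves by one
step of p because T > m is an event of the filtration at time m. *)
Lemma stopping_balance m j :
  pr P (stopped_before m j) + pr P (alive m `&` X m @^-1` [set j])
  = mu j + \sum_i expected_visits m i * p i j - expected_visits m j.
Proof.
elim: m => [|m IH].
  rewrite stopped_before0 pr0 alive0 setTI (pr_init hX) add0r.
  rewrite /expected_visits big_ord0 big1 => [|i _]; last by rewrite big_ord0 mul0r.
  by rewrite addr0 subr0.
have -> : pr P (alive m.+1 `&` X m.+1 @^-1` [set j]) = \sum_i pr_continue m i * p i j.
  exact: (markov_flow hX hUX _ (@filtration_aliveS m)).
have visitsS i : expected_visits m.+1 i = expected_visits m i + pr_continue m i.
  by rewrite /expected_visits big_ord_recr.
under [in RHS]eq_bigr do rewrite visitsS mulrDl.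
rewrite big_split/= visitsS pr_stopped_beforeS.
by move: IH; rewrite pr_alive_split; lra.
Qed.

Lemma sum_expected_visits m : \sum_i expected_visits m i = \sum_(t < m) pr P (alive t.+1).
Proof.
rewrite exchange_big/=; apply: eq_bigr => t _.
by rewrite -(pr_state_split hX)//; exact: measurable_alive.
Qed.

Lemma expected_visits_ge0 m i : 0 <= expected_visits m i.
Proof. by apply: sumr_ge0 => t _; exact: pr_ge0. Qed.

(** The events T > t decrease in t, so each of the first m of them is at
least as likely as T >= m. *)
Lemma alive_le_expected_visits m : m%:R * pr P (alive m) <= \sum_i expected_visits m i.
Proof.
rewrite sum_expected_visits mulr_natl -[X in _ *+ X]card_ord -sumr_const.
apply: ler_sum => t _; apply: le_pr; [exact: measurable_alive..|].
exact: sub_alive.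
Qed.

Lemma stopped_in_bigcup i : stopped_in i = \bigcup_m stopped_before m i.
Proof.
apply/seteqP; split=> w; first by move=> [k Tk Xi]; exists k.+1 => //; exists k.
by move=> [m _ [k Tk [_ Xi]]]; exists k.
Qed.

Lemma measurable_stopped_in i : measurable (stopped_in i).
Proof.
by rewrite stopped_in_bigcup; apply: bigcup_measurable => m _;
  exact: measurable_stopped_before.
Qed.

Lemma stopped_in_ge m i : pr P (stopped_before m i) <= pr P (stopped_in i).
Proof.
apply: le_pr; [exact: measurable_stopped_before|exact: measurable_stopped_in|].
by move=> w [k Tk [_ Xi]]; exists k.
Qed.

(** With [stopped_in_ge], this shows that truncation at m changes the stopped
law by at most P(T >= m). *)
Lemma stopped_in_le m i :
  pr P (stopped_in i) <= pr P (stopped_before m i) + pr P (alive m).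
Proof.
have ms : measurable (stopped_before m i `\` alive m).
  by apply: measurableD; [exact: measurable_stopped_before|exact: measurable_alive].
rewrite (le_trans (y := pr P (stopped_before m i `\` alive m `|` alive m)))//.
  apply: le_pr; [exact: measurable_stopped_in|
    by apply: measurableU => //; exact: measurable_alive|].
  move=> w [k Tk Xi]; have [km|mk] := ltnP k m.
    case: (pselect (alive m w)); [by right|by left; split=> //; exists k].
  by right=> l lm; rewrite Tk => -[kl]; move: lm; rewrite -kl ltnNge mk.
rewrite prU//; [|exact: measurable_alive|].
  by rewrite lerD2r; apply: le_pr => //; exact: measurable_stopped_before.
by apply/seteqP; split=> // w [[_ +] +].
Qed.

(** T counts the t with T > t; both sides are infinite if T is. *)
Lemma time_val_series w :
  time_val R (T w) = (\sum_(0 <= t <oo) (\1_(alive t.+1) w)%:E)%E.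
Proof.
have ge0 t : (0%N <= t)%N -> (0 <= (\1_(alive t.+1) w)%:E :> \bar R)%E.
  by move=> _; rewrite lee_fin.
have count m : (forall k, T w = Some k -> (m <= k)%N) ->
    (\sum_(0 <= t < m) (\1_(alive t.+1) w)%:E = (m%:R : R)%:E)%E.
  move=> h; rewrite sumEFin big_mkord; congr (_%:E).
  rewrite (eq_bigr (fun=> 1)) ?sumr_const ?card_ord// => t _.
  rewrite indicE mem_set// => k kt Tk.
  by move: (h k Tk); rewrite leqNgt (leq_ltn_trans _ (ltn_ord t)).
case Tw : (T w) => [k|] /=.
  rewrite (nneseries_split _ k)// add0n eseries0 ?adde0.
    by rewrite count// => k'; rewrite Tw => -[->].
  move=> t kt _; rewrite indicE memNset// => /(_ k); rewrite ltnS => /(_ kt).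
  by rewrite Tw.
apply/esym/eq_infty => r.
apply: (@le_trans _ _ ((Num.truncn r).+1%:R%:E)%E).
  by rewrite lee_fin ltW// truncnS_gt.
rewrite -count; first exact: nneseries_lim_ge.
by move=> k; rewrite Tw.
Qed.

Lemma mean_time_series : mean_time P T = (\sum_(0 <= t <oo) (pr P (alive t.+1))%:E)%E.
Proof.
rewrite /mean_time; under eq_integral do rewrite time_val_series.
rewrite integral_nneseries//; first last.
- move=> t; apply/measurable_EFinP; apply: measurable_indic; exact: measurable_alive.
apply: eq_eseriesr => t _.
rewrite integral_indic//; last exact: measurable_alive.
by rewrite setIT; apply: pr_EFin; exact: measurable_alive.
Qed.

Lemma expected_visits_le_mean_time m : ((\sum_i expected_visits m i)%:E <= mean_time P T)%E.
Proof.
rewrite mean_time_series sum_expected_visits -sumEFin.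
rewrite -(big_mkord xpredT (fun t => (pr P (alive t.+1))%:E)).
by apply: nneseries_lim_ge => t _ _; rewrite lee_fin pr_ge0.
Qed.

Lemma mean_time_le_expected_visits C : (forall m, \sum_i expected_visits m i <= C) ->
  (mean_time P T <= C%:E)%E.
Proof.
move=> h; rewrite mean_time_series; apply: lime_le.
  by apply: is_cvg_nneseries => t _ _; rewrite lee_fin pr_ge0.
near=> m; rewrite big_mkord sumEFin lee_fin -sum_expected_visits; exact: h.
Unshelve. all: by end_near.
Qed.

End StoppingTimes.

(** * Stopping rules driven by one uniform threshold *)

Section ThresholdRule.
Context (R : realType) (S : finType) (d : measure_display).
Context (Omega : measurableType d) (P : probability Omega R).
Context (mu : S -> R) (p : S -> S -> R).
Context (U : {RV P >-> R}) (X : nat -> Omega -> S).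
Hypothesis hX : markov_chain P mu p X.
Hypothesis hU : uniform01 U.
Hypothesis hUX : indep_rv_process U X.
Context (q : nat -> S -> R).
Hypothesis q01 : forall t i, 0 <= q t i <= 1.

(** The conditional probability, given the path x, of not halting before time
m when the halting probabilities are q. *)
Definition survival m (x : nat -> S) : R := \prod_(k < m) (1 - q k (x k)).

(** The first time k at which the survival probability of the path up to and
including time k drops to U or below. *)
Definition threshold_rule (w : Omega) : option nat :=
  match pselect (exists k, survival k.+1 (X^~ w) <= U w) with
  | left e => Some (ex_minn (P := fun k => survival k.+1 (X^~ w) <= U w) e)
  | right _ => None
  end.

Lemma survivalS m x : survival m.+1 x = survival m x * (1 - q m (x m)).
Proof. by rewrite /survival big_ord_recr. Qed.

Lemma survival_itv m x : 0 <= survival m x <= 1.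
Proof.
have h (k : 'I_m) : 0 <= 1 - q k (x k) <= 1 by have := q01 k (x k); lra.
by apply/andP; split; [apply: prodr_ge0 => k _; case/andP: (h k)|exact: prodr_ile1].
Qed.

Lemma survival_le m m' x : (m <= m')%N -> survival m' x <= survival m x.
Proof.
move=> /subnK <-; elim: (m' - m)%N => [|k IH]; first by rewrite add0n.
rewrite addSn survivalS (le_trans _ IH)//.
have := survival_itv (k + m) x; have := q01 (k + m) (x (k + m)%N); nra.
Qed.

Lemma eq_survival m x y : (forall k, (k < m)%N -> x k = y k) ->
  survival m x = survival m y.
Proof. by move=> xy; apply: eq_bigr => k _; rewrite xy. Qed.

(** Survival probabilities decrease along a path, so U is below the last one
exactly when it is below all of them. *)
Lemma alive_threshold m :
  alive threshold_rule m.+1 = [set w | U w < survival m.+1 (X^~ w)].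
Proof.
apply/seteqP; split=> w.
  rewrite /alive /threshold_rule /= ltNge => h; apply/negP => le.
  case: pselect h => [e|]; last by case; exists m.
  case: ex_minnP => k _ /(_ m le) km /(_ k); rewrite ltnS => /(_ km); exact.
move=> /= lt k; rewrite ltnS /threshold_rule => km; case: pselect => [e|//].
case: ex_minnP => l le _ [lk]; move: le; rewrite lk leNgt (lt_le_trans lt)//.
exact: survival_le.
Qed.

Lemma alive_threshold_cylinder m t x : (m <= t)%N ->
  alive threshold_rule m.+1 `&` cylinder X t x
  = U @^-1` `]-oo, survival m.+1 x[ `&` cylinder X t x.
Proof.
move=> mt; rewrite alive_threshold.
have sE w : cylinder X t x w -> survival m.+1 (X^~ w) = survival m.+1 x.
  by move=> cw; apply: eq_survival => k km; rewrite cw// (leq_trans _ mt).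
by apply/seteqP; split=> w [/= Uw cw]; split=> //; move: Uw;
  rewrite /= in_itv/= sE.
Qed.

Lemma threshold_rule_stopping : stopping_time U X threshold_rule.
Proof.
move=> t; rewrite -[X in filtration _ _ _ X]setCK -aliveSE.
apply: sigma_algebraC; apply: filtration_of_cylinders => x.
by exists `]-oo, survival t.+1 x[%classic => //; exact: alive_threshold_cylinder.
Qed.

Lemma pr_below (h : R) : 0 <= h <= 1 -> pr P (U @^-1` `]-oo, h[) = h.
Proof.
move=> /andP[h0 h1]; rewrite /pr hU//= /uniform_prob integral_uniform_pdf.
have -> : `]-oo, h[ `&` `[0, 1] = `[0, h[%classic :> set R.
  apply/seteqP; split=> x; rewrite /= !in_itv/=; first by case=> -> /andP[->].
  by move=> /andP[-> xh]; split=> //=; rewrite ltW// (lt_le_trans xh).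
rewrite (eq_integral (fun=> 1%E)); last first.
  move=> x; rewrite inE/= in_itv/= /uniform_pdf => /andP[-> xh].
  by rewrite ltW ?subr0 ?invr1// (lt_le_trans xh).
rewrite integral_cst//= mul1e lebesgue_measure_itv/= lte_fin.
case: ifPn => [_|]; first by rewrite sube0.
by rewrite -leNgt => hle; apply: le_anti; rewrite h0 hle.
Qed.

(** U is uniform and independent of the path. *)
Lemma pr_alive_cylinder m t x : (m <= t.+1)%N ->
  pr P (alive threshold_rule m `&` cylinder X t x)
  = survival m x * pr P (cylinder X t x).
Proof.
case: m => [_|m mt].
  by rewrite alive0 setTI /survival big_ord0 mul1r.
by rewrite alive_threshold_cylinder// (pr_indep hX hUX)// pr_below ?survival_itv.
Qed.

(** Summing over the paths that end in i at time m, the last factor of the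
survival probability depends on i only and comes out of the sum. This realizes
the prescribed conditional halting probabilities. *)
Lemma pr_continue_threshold m i :
  pr_continue P X threshold_rule m i
  = (1 - q m i) * pr P (alive threshold_rule m `&` X m @^-1` [set i]).
Proof.
have mA m' : measurable (alive threshold_rule m' `&` X m @^-1` [set i]).
  by apply: (measurable_at hX); exact: threshold_rule_stopping.
rewrite /pr_continue !(pr_paths hX m (mA _)) mulr_sumr; apply: eq_bigr => f _.
have [fi|fi] := eqVneq (extend f m) i; last first.
  (* Paths that do not end in i contribute nothing. *)
  have e0 A : A `&` X m @^-1` [set i] `&` cylinder X m (extend f) = set0.
    apply/seteqP; split=> // w [[_ /= Xi] cw]; move: fi.
    by rewrite -Xi cw ?eqxx.
  by rewrite !e0 pr0 mulr0.
have ci A : A `&` X m @^-1` [set i] `&` cylinder X m (extend f)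
    = A `&` cylinder X m (extend f).
  by rewrite -setIA; congr (_ `&` _); apply: setIidr => w cw /=; rewrite cw.
by rewrite !ci !pr_alive_cylinder// survivalS fi; ring.
Qed.

End ThresholdRule.

(** * The filling rule as a stopping time *)

Section FillingRule.
Context (R : realType) (S : finType) (d : measure_display).
Context (Omega : measurableType d) (P : probability Omega R).
Context (mu nu : S -> R) (p : S -> S -> R).
Context (U : {RV P >-> R}) (X : nat -> Omega -> S).
Hypothesis hX : markov_chain P mu p X.
Hypothesis hU : uniform01 U.
Hypothesis hUX : indep_rv_process U X.
Hypothesis p_ge0 : forall i j, 0 <= p i j.
Hypothesis p_sum1 : forall i, \sum_j p i j = 1.
Hypotheses (mu_distr : is_distr mu) (nu_distr : is_distr nu).

(** The fraction of the incoming mass that the filling scheme stops; it is 0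
by division by 0 where no mass comes in, which is harmless. *)
Definition halt_prob t i : R := filled p mu nu t i / incoming p mu nu t i.

Lemma halt_prob_itv t i : 0 <= halt_prob t i <= 1.
Proof.
have a0 := incoming_ge0 nu p_ge0 mu_distr t i.
have f0 := filled_ge0 p_ge0 mu_distr nu_distr t i.
rewrite /halt_prob divr_ge0//=.
have [->|an0] := eqVneq (incoming p mu nu t i) 0; first by rewrite invr0 mulr0.
have a_gt0 : 0 < incoming p mu nu t i by rewrite lt_neqAle eq_sym an0.
by rewrite ler_pdivrMr// mul1r ge_min lexx.
Qed.

Lemma overflow_halt_prob t i :
  overflow p mu nu t i = (1 - halt_prob t i) * incoming p mu nu t i.
Proof.
rewrite /halt_prob; have [a0|an0] := eqVneq (incoming p mu nu t i) 0.
  have := overflow_ge0 p mu nu t i.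
  have := filled_ge0 p_ge0 mu_distr nu_distr t i.
  by rewrite /overflow a0; lra.
by rewrite mulrBl mul1r divfK.
Qed.

Definition filling_rule := threshold_rule U X halt_prob.

Lemma filling_rule_stopping : stopping_time U X filling_rule.
Proof. exact: threshold_rule_stopping halt_prob_itv. Qed.

(** The law of the process that has not yet stopped is the moving mass of the
filling scheme, by induction on m: the halting probabilities produce the
overflow, and the Markov property transports it. *)
Lemma pr_alive_incoming m i :
  pr P (alive filling_rule m `&` X m @^-1` [set i]) = incoming p mu nu m i.
Proof.
elim: m i => [|m IH] i; first by rewrite alive0 setTI (pr_init hX).
rewrite (markov_flow hX hUX _ (filtration_aliveS filling_rule_stopping (m := m))).
rewrite incomingS; apply: eq_bigr => j _.
rewrite -/(pr_continue P X filling_rule m j)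
  (pr_continue_threshold hX hU hUX halt_prob_itv) IH.
by rewrite overflow_halt_prob.
Qed.

Lemma continue_filling m i : pr_continue P X filling_rule m i = overflow p mu nu m i.
Proof.
by rewrite (pr_continue_threshold hX hU hUX halt_prob_itv) pr_alive_incoming
  overflow_halt_prob.
Qed.

Lemma expected_visits_filling m i : expected_visits P X filling_rule m i
  = total_overflow p mu nu m i.
Proof. by apply: eq_bigr => t _; rewrite continue_filling. Qed.

Lemma pr_stopped_before_filling m i :
  pr P (stopped_before X filling_rule m i) = nu i - demand p mu nu m i.
Proof.
have := stopping_balance hX hUX filling_rule_stopping m i.
have := total_overflow_balance p mu nu m i.
rewrite pr_alive_incoming expected_visits_filling.
under [in X in _ -> X -> _]eq_bigr do rewrite expected_visits_filling.
lra.
Qed.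

(** The unmet demand and the mass alive have the same total. *)
Lemma demand_le_alive m i : demand p mu nu m i <= pr P (alive filling_rule m).
Proof.
rewrite (pr_state_split hX m (measurable_alive hX filling_rule_stopping m)).
under eq_bigr do rewrite pr_alive_incoming.
rewrite (sum_incoming_demand p_sum1 mu_distr nu_distr) (bigD1 i)//= lerDl.
by apply: sumr_ge0 => j _; exact: demand_ge0.
Qed.

(** The bound on the total overflow gives m P(T >= m) <= C, so P(T >= m)
tends to 0. Then T is almost surely finite, and the law of X_T, which differs
from nu by at most P(T >= m), equals nu. *)
Lemma filling_rule_admissible (C : R) :
  (forall m, \sum_i total_overflow p mu nu m i <= C) ->
  [/\ as_finite P filling_rule, stopped_law P X filling_rule nu
    & (mean_time P filling_rule <= C%:E)%E].
Proof.
move=> hC; have st := filling_rule_stopping.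
have visitsC m : \sum_i expected_visits P X filling_rule m i <= C.
  by under eq_bigr do rewrite expected_visits_filling.
have tail m : m%:R * pr P (alive filling_rule m) <= C.
  exact: le_trans (alive_le_expected_visits hX st m) _.
have null y : (forall m, y <= pr P (alive filling_rule m)) -> y <= 0.
  move=> h; apply: (@archimedean_le0 _ y C) => m.
  by rewrite (le_trans _ (tail m))// ler_wpM2l.
split; last exact: (mean_time_le_expected_visits hX st).
  have mN : measurable (\bigcap_m alive filling_rule m).
    by apply: bigcap_measurable => // m _; exact: (measurable_alive hX st).
  exists (\bigcap_m alive filling_rule m); split=> //.
    rewrite pr_EFin//; congr (_%:E); apply: le_anti; rewrite pr_ge0 andbT.
    apply: null => m; apply: le_pr => //; first exact: (measurable_alive hX st).
    exact: bigcap_inf.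
  by move=> w /= /contrapT Tw m _ k _; rewrite Tw.
move=> i; rewrite -/(stopped_in X filling_rule i) pr_EFin; last first.
  exact: (measurable_stopped_in hX st).
congr (_%:E); apply: le_anti; rewrite -subr_le0 -[X in _ && X]subr_le0.
apply/andP; split; apply: null => m.
  have := stopped_in_le hX st m i; rewrite pr_stopped_before_filling.
  have := demand_ge0 p mu nu_distr m i; lra.
have := stopped_in_ge hX st m i; rewrite pr_stopped_before_filling.
have := demand_le_alive m i; lra.
Qed.

End FillingRule.

(** * The lower bound on the star *)

Section StarBounds.
Context (R : realType) (n : nat).
Hypothesis n_gt0 : (0 < n)%N.
Context (mu nu : 'I_n.+1 -> R).
Context (d : measure_display) (Omega : measurableType d).
Context (P : probability Omega R) (U : {RV P >-> R}) (X : nat -> Omega -> 'I_n.+1).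
Hypothesis hX : markov_chain P mu (@star_trans R n) X.
Hypothesis hUX : indep_rv_process U X.

(** Only a stopping time of finite mean needs an argument; for it, the balance
truncated at m holds up to an error D = P(T >= m) with m D <= E T. *)
Lemma star_mean_time_ge T (j : 'I_n.+1) : j != ord0 ->
  stopping_time U X T -> stopped_law P X T nu ->
  ((nu ord0 - mu ord0 + (2 * n)%:R * Num.max (nu j - mu j) 0)%:E
    <= mean_time P T)%E.
Proof.
move=> j0 st law.
have := expected_visits_le_mean_time hX st; case E : (mean_time P T) => [e| |] he;
  [|by rewrite leey|by have := he 0%N].
rewrite lee_fin -subr_le0.
have law' i : pr P (stopped_in X T i) = nu i by rewrite /pr law.
have bal i m : nu i - pr P (alive T m) <=
    mu i + \sum_k expected_visits P X T m k * star_trans R k i - expected_visits P X T m i.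
  rewrite -(stopping_balance hX hUX st).
  have := stopped_in_le hX st m i; rewrite law'.
  have := pr_ge0 P (alive T m `&` X m @^-1` [set i]); lra.
apply: (@archimedean_le0 _ _ ((2 * n + 1)%:R * e)) => m.
have tail := le_trans (alive_le_expected_visits hX st m) (he m).
have gn := bal j m; have g0 := bal ord0 m.
rewrite star_flow_leaf// in gn; rewrite star_flow0 in g0.
have sumE : \sum_k expected_visits P X T m k <= e by rewrite -lee_fin he.
rewrite (bigD1 ord0)//= in sumE.
have gj := expected_visits_ge0 P X T m j; have gz := expected_visits_ge0 P X T m ord0.
set D := pr P (alive T m) in gn g0 tail *.
have D0 : 0 <= D by exact: pr_ge0.
have n0 : (0 : R) < n%:R by rewrite ltr0n.
have key : n%:R * (Num.max (nu j - mu j) 0 - D) <= expected_visits P X T m ord0.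
  rewrite mulrC -ler_pdivlMr//.
  have := divr_ge0 gz (ltW n0).
  by case: (leP (nu j - mu j) 0) => *; lra.
rewrite (le_trans (y := m%:R * ((2 * n + 1)%:R * D)))//; last first.
  by rewrite mulrCA ler_wpM2l.
apply: ler_wpM2l => //.
rewrite natrD natrM; move: key; set M := Num.max _ _; lra.
Qed.

End StarBounds.

(** * Total variation and conclusion *)

Section TotalVariation.
Context (R : realType) (S : finType) (mu nu : S -> R).
Hypotheses (dmu : is_distr mu) (dnu : is_distr nu).

Lemma distr_mass_itv (m : S -> R) (A : {set S}) : is_distr m ->
  0 <= \sum_(i in A) m i <= 1.
Proof.
move=> [m0 m1]; rewrite sumr_ge0//= -m1 [leRHS](bigID (mem A))/= lerDl.
exact: sumr_ge0.
Qed.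

Lemma tv_diff_le1 (A : {set S}) : `|\sum_(i in A) mu i - \sum_(i in A) nu i| <= 1.
Proof.
by have := distr_mass_itv A dmu; have := distr_mass_itv A dnu; rewrite ler_norml; lra.
Qed.

Lemma tv_dist_le1 : tv_dist mu nu <= 1.
Proof.
apply: ge_sup; first by
  exists `|\sum_(i in finset.set0) mu i - \sum_(i in finset.set0) nu i|,
    finset.set0.
by move=> _ [A _ <-]; exact: tv_diff_le1.
Qed.

Lemma diff_le_tv_dist i : nu i - mu i <= tv_dist mu nu.
Proof.
rewrite (le_trans (y := `|\sum_(k in [set i]%SET) mu k - \sum_(k in [set i]%SET) nu k|))//.
  by rewrite !big_set1 distrC ler_norm.
apply: ub_le_sup; last by exists [set i]%SET.
by exists 1 => _ [A _ <-]; exact: tv_diff_le1.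
Qed.

Lemma tv_dist_ge0 : 0 <= tv_dist mu nu.
Proof.
rewrite (le_trans (y := `|\sum_(i in finset.set0) mu i - \sum_(i in finset.set0) nu i|))//.
apply: ub_le_sup; last by exists finset.set0.
by exists 1 => _ [A _ <-]; exact: tv_diff_le1.
Qed.

End TotalVariation.

(** The supremum over a finite nonempty family is a maximum. *)
Lemma sup_image_attained (R : realType) (I : finType) (D : pred I) (f : I -> R) :
  (exists i, D i) ->
  exists i, [/\ D i, sup [set f j | j in [set j | D j]] = f i
              & forall j, D j -> f j <= f i].
Proof.
move=> [i0 Di0]; exists [arg max_(i > i0 | D i) f i]%O.
case: Order.TotalTheory.arg_maxP => // i Di fi; split=> //.
apply/le_anti/andP; split.
  by apply: ge_sup; [exists (f i0), i0|move=> _ [j Dj <-]; exact: fi].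
apply: ub_le_sup; last by exists i.
by exists (f i) => _ [j Dj <-]; exact: fi.
Qed.

Lemma odd_nat_bigO (R : realType) :
  (fun m : nat => (2 * m + 1)%:R : R) =O_\oo (fun m : nat => m%:R : R).
Proof.
apply/eqO_exP; exists 3; first exact: ltr0n.
near=> m.
have m1 : (1 <= m)%N by near: m; exact: nbhs_infty_ge.
rewrite !normr_nat -natrM ler_nat; lia.
Unshelve. all: by end_near.
Qed.

Theorem theorem2p6 (R : realType) (n : nat) (hn : (1 <= n)%N)
  (mu nu : 'I_n.+1 -> R) (hmu : is_distr mu) (hnu : is_distr nu)
  (d : measure_display) (Omega : measurableType d) (P : probability Omega R)
  (U : {RV P >-> R}) (X : nat -> Omega -> 'I_n.+1)
  (hX : markov_chain P mu (@star_trans R n) X)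
  (hU : uniform01 U) (hUX : indep_rv_process U X) :
  [/\ transport_time U X nu
      = (nu ord0 - mu ord0
         + (2 * n)%:R * Num.max (sup [set nu j - mu j | j in [set j | j != ord0]])
                                0)%:E,
      forall j : 'I_n.+1, j != ord0 ->
        ((nu ord0 - mu ord0 + (2 * n)%:R * Num.max (nu j - mu j) 0)%:E
           <= transport_time U X nu)%E,
      (transport_time U X nu <= ((2 * n + 1)%:R * tv_dist mu nu)%:E)%E,
      (2 * n + 1)%:R * tv_dist mu nu <= (2 * n + 1)%:R
    & (fun m : nat => (2 * m + 1)%:R : R) =O_\oo (fun m : nat => m%:R : R)].

Proof.
have n_gt0 : (0 < n)%N by [].
have [j0 [j0N supE leaf_le]] : exists i : 'I_n.+1,
    [/\ i != ord0, sup [set nu j - mu j | j in [set j : 'I_n.+1 | j != ord0]]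
                   = nu i - mu i
      & forall j, j != ord0 -> nu j - mu j <= nu i - mu i].
  apply: (@sup_image_attained R _ (fun j => j != ord0) (fun j => nu j - mu j)).
  by exists ord_max; rewrite -val_eqE/= -lt0n.
have lower j : j != ord0 ->
    ((nu ord0 - mu ord0 + (2 * n)%:R * Num.max (nu j - mu j) 0)%:E
     <= transport_time U X nu)%E.
  move=> jN; apply: le_ereal_inf_tmp => _ [T [st _ law] <-].
  exact: (star_mean_time_ge n_gt0 hX hUX jN).
have timeE : transport_time U X nu
    = (nu ord0 - mu ord0 + (2 * n)%:R * Num.max (nu j0 - mu j0) 0)%:E.
  apply/le_anti/andP; split; last exact: lower.
  have M0 : 0 <= Num.max (nu j0 - mu j0) 0 by rewrite le_max lexx orbT.
  have hM j : j != ord0 -> nu j - mu j <= Num.max (nu j0 - mu j0) 0.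
    by move=> jN; rewrite le_max leaf_le.
  have [fin law le] := filling_rule_admissible hX hU hUX (@star_trans_ge0 R n)
    (star_trans_sum1 R n_gt0) hmu hnu
    (fun m => star_filling_bound n_gt0 m hmu hnu M0 hM).
  apply: ge_ereal_inf; exists (mean_time P (filling_rule mu nu (@star_trans R n) U X)) => //.
  exists (filling_rule mu nu (@star_trans R n) U X) => //; split=> //.
  exact: (filling_rule_stopping (@star_trans_ge0 R n) hmu hnu).
split.
- by rewrite supE.
- exact: lower.
- rewrite timeE lee_fin natrD natrM.
  have d0 := diff_le_tv_dist hmu hnu ord0.
  have dM : Num.max (nu j0 - mu j0) 0 <= tv_dist mu nu.
    by rewrite ge_max diff_le_tv_dist// tv_dist_ge0.
  have n0 : (0 : R) <= n%:R by [].
  have := ler_wpM2l n0 dM; set M := Num.max _ _; lra.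
- by rewrite ler_piMr// tv_dist_le1.
- exact: odd_nat_bigO.
Qed.
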